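(* Let $k \geq 2$ and $t \geq 2k-1$ be integers. If $G$ is a graph with $\operatorname{Mad}(G) < 2k\left(1-\frac{k}{t+1}\right)$, then $G$ is $(k,t)$-choosable.
   Context: Graphs are finite and simple. The maximum average degree $\operatorname{Mad}(G)$ of a graph $G$ is the maximum of $\frac{2|E(H)|}{|V(H)|}$ over all (nonempty) subgraphs $H \subseteq G$. For integers $t \geq k$, a $(k,t)$-list assignment of a graph $G$ (union separation) is a function $L$ assigning to each vertex $v$ a set $L(v)$ of colors such that $|L(v)| \geq k$ for all vertices $v$ and $|L(u)\cup L(v)| \geq t$ for all edges $uv$. An $L$-coloring is an assignment $c$ of colors to the vertices with $c(v) \in L(v)$ for all vertices $v$ and $c(u)\neq c(v)$ for all adjacent $u,v$. A graph is $(k,t)$-choosable if it has an $L$-coloring for every $(k,t)$-list assignment $L$. *)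

(* Defs.v *)
From mathcomp Require Import all_boot all_order all_algebra.
From mathcomp Require Import boolp classical_sets functions cardinality.

Set Implicit Arguments.
Unset Strict Implicit.
Unset Printing Implicit Defensive.

Import Order.TTheory GRing.Theory Num.Theory.

Local Open Scope ring_scope.

Record sgraph := SGraph {
  vertex :> finType;
  adj : rel vertex;
  adj_sym : symmetric adj;
  adj_irrefl : irreflexive adj }.

Definition edges (G : sgraph) : {set {set G}} :=
  [set e : {set G} | [exists x : G, exists y : G, adj x y && (e == [set x; y])]].

(* H = (W, F) stands for the graph with vertex set W and edge set F; it need
   not be an induced subgraph of G. *)
Definition is_subgraph (G : sgraph) (H : {set G} * {set {set G}}) : bool :=
  (H.2 \subset edges G) && [forall e in H.2, e \subset H.1].

Definition avg_degree (G : sgraph) (H : {set G} * {set {set G}}) : rat :=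
  (2 * #|H.2|)%:R / #|H.1|%:R.

(* Average degrees are nonnegative, so the base value 0 does not affect the
   maximum; it only gives Mad = 0 to the graph without vertices. *)
Definition Mad (G : sgraph) : rat :=
  \big[Num.max/0]_(H : {set G} * {set {set G}} |
                   is_subgraph H && (H.1 != finset.set0)) avg_degree H.

(* Lists are arbitrary, possibly infinite, sets; [`I_n #<= A] says |A| >= n. *)
Definition list_assignment (k t : nat) (G : sgraph) (C : Type)
    (L : G -> set C) : Prop :=
  (forall v, (`I_k #<= L v)%card) /\
  (forall u v, adj u v -> (`I_t #<= (L u `|` L v)%classic)%card).

Definition list_coloring (G : sgraph) (C : Type) (L : G -> set C)
    (c : G -> C) : Prop :=
  (forall v, L v (c v)) /\ (forall u v, adj u v -> c u <> c v).

Definition choosable (k t : nat) (G : sgraph) : Prop :=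
  forall (C : Type) (L : G -> set C),
    list_assignment k t L -> exists c : G -> C, list_coloring L c.

(* Main.v *)
(** Edges whose end lists are disjoint never constrain a coloring, so discard
    them.  In a subset W that cannot be colored greedily, every vertex v
    satisfies |L(v)| <= d(v) in the remaining graph, and the lists of adjacent
    u, v share a color, whence k <= d(v) and t + 1 <= d(u) + d(v).  Counting W
    as the sum over edges of 1/d(u) + 1/d(v), each term being at most
    1/k + 1/(t+1-k), bounds the average degree from below by the harmonic mean
    of k and t + 1 - k, which is 2k(1 - k/(t+1)). *)
Require Import Defs.
From mathcomp Require Import all_boot all_order all_algebra.
From mathcomp Require Import zify ring lra finmap.
From mathcomp Require Import boolp classical_sets functions cardinality.

Import Order.TTheory GRing.Theory Num.Theory.
Local Open Scope ring_scope.

(** If [b <= x], compare termwise. Otherwise lower [y] to [a + b - x]: at the fixed sum [a + b] the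
    reciprocals add up to [a + b] over the product, which is least at the pair [a], [b], since x (a
    + b - x) - a b = (x - a)(b - x). *)
Lemma invD_le_invD (F : realFieldType) (a b x y : F) :
  0 < a -> a <= b -> a <= x -> a <= y -> a + b <= x + y ->
  x^-1 + y^-1 <= a^-1 + b^-1.
Proof.
move=> a0 ab ax ay abxy.
have b0 : 0 < b by lra.
have x0 : 0 < x by lra.
have y0 : 0 < y by lra.
case: (lerP b x) => [bx|xb].
  by rewrite addrC lerD // lef_pV2 // ?posrE.
have z0 : 0 < a + b - x by lra.
have zy : a + b - x <= y by lra.
apply: (@le_trans _ _ (x^-1 + (a + b - x)^-1)).
  by rewrite lerD2l lef_pV2 // ?posrE.
have -> : x^-1 + (a + b - x)^-1 = (a + b) / (x * (a + b - x)).
  by field; rewrite !gt_eqF.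
have -> : a^-1 + b^-1 = (a + b) / (a * b) by field; rewrite !gt_eqF.
rewrite ler_pM2l; last by lra.
rewrite lef_pV2 ?posrE ?mulr_gt0 // -subr_ge0.
have -> : x * (a + b - x) - a * b = (x - a) * (b - x) by ring.
by rewrite mulr_ge0 // subr_ge0 // ltW.
Qed.

(** Each fibre of the map from ordered to unordered pairs is {(x, y), (y, x)}, and these two differ
    because [x != y]. *)
Lemma card_unordered_pairs (T : finType) (P : {set T * T}) :
  (forall x y, (x, y) \in P -> (x != y) && ((y, x) \in P)) ->
  (2 * #|[set [set p.1; p.2] | p in P]| = #|P|)%N.
Proof.
move=> symP; rewrite -[in RHS]sum1_card.
rewrite (partition_big_imset (fun p : T * T => [set p.1; p.2])) /=.
rewrite (eq_bigr (fun=> 2%N)) => [|_ /imsetP[[x y] Pxy ->] /=].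
  by rewrite sum_nat_const mulnC.
have /andP[xy Pyx] := symP _ _ Pxy.
transitivity #|[set (x, y); (y, x)]|; last first.
  by rewrite cards2 xpair_eqE negb_and xy.
rewrite sum1dep_card; apply: eq_card => -[u v]; rewrite !inE /= !xpair_eqE.
apply/andP/idP => [[Puv /eqP uvE]|/orP[]/andP[/eqP-> /eqP->]]; last 2 first.
- by split.
- by split=> //; rewrite finset.setUC.
have : u \in [set x; y] by rewrite -uvE !inE eqxx.
have : v \in [set x; y] by rewrite -uvE !inE eqxx orbT.
have /andP[uv _] := symP _ _ Puv.
rewrite !inE => /orP[]/eqP vE /orP[]/eqP uE; move: uv; rewrite uE vE ?eqxx //.
by rewrite orbT.
Qed.

Section InducedDegrees.
Variables (T : finType) (e : rel T) (W : {set T}).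
Hypothesis e_sym : symmetric e.

Definition nbhd_in (v : T) : {set T} := [set u in W | e v u].

Definition arcs_in : {set T * T} :=
  [set p | [&& p.1 \in W, p.2 \in W & e p.1 p.2]].

Lemma harmonic_arcs_bound (a b : nat) :
  (0 < a)%N -> (a <= b)%N ->
  (forall v, v \in W -> (a <= #|nbhd_in v|)%N) ->
  (forall u v, u \in W -> v \in W -> e u v ->
     (a + b <= #|nbhd_in u| + #|nbhd_in v|)%N) ->
  (2 * #|W|)%:R <= #|arcs_in|%:R * (a%:R^-1 + b%:R^-1) :> rat.
Proof.
move=> a0 ab degW degE.
pose f v : rat := (#|nbhd_in v|%:R)^-1.
(* Group the arcs by first end: each [u] in [W] contributes d(u) terms 1/d(u), hence 1, as [a > 0]
   makes d(u) nonzero. Reversing arcs gives the same sum over second ends. *)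
have sumf : \sum_(p in arcs_in) f p.1 = #|W|%:R.
  transitivity (\sum_(u in W) \sum_(v in nbhd_in u) f u).
    by rewrite pair_big_dep /=; apply: eq_bigl => -[u v]; rewrite !inE.
  rewrite (eq_bigr (fun=> 1)) => [|u uW]; first by rewrite sumr_const.
  rewrite sumr_const /f -[LHS]mulr_natl divff // pnatr_eq0 -lt0n.
  exact: leq_trans a0 (degW _ uW).
have sumf2 : \sum_(p in arcs_in) f p.2 = #|W|%:R.
  rewrite -sumf (reindex_inj (h := fun p => (p.2, p.1))) /=; last first.
    by move=> [u v] [u' v'] [-> ->].
  by apply: eq_bigl => -[u v]; rewrite !inE e_sym andbCA.
rewrite natrM mulrDl mul1r -{1}sumf -sumf2 -big_split /= mulr_natl -sumr_const.
apply: ler_sum => -[u v]; rewrite inE /= => /and3P[uW vW euv].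
by apply: invD_le_invD; rewrite ?ltr0n -?natrD ?ler_nat ?degW ?degE.
Qed.

End InducedDegrees.

Lemma avg_degree_le_Mad (G : sgraph) (H : {set G} * {set {set G}}) :
  is_subgraph H -> H.1 != finset.set0 -> avg_degree H <= Mad G.
Proof. by move=> HG H0; apply: le_bigmax_cond; rewrite HG. Qed.

(** Pigeonhole: otherwise [A] lies in the image of [N] under [c], which has at most [#|N|]
    elements. *)
Lemma exists_outside_image (C : Type) (T : finType) (A : set C) (c : T -> C)
    (N : {set T}) :
  (`I_(#|N|).+1 #<= A)%card -> exists2 x, A x & forall u, u \in N -> c u <> x.
Proof.
move=> NA; apply: contrapT => noA.
have sub : (A `<=` (fun i : 'I_#|N| => c (enum_val i)) @` setT)%classic.
  move=> x Ax; apply: contrapT => xN; apply: noA; exists x => // u uN cu.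
  by apply: xN; exists (enum_rank_in uN u); rewrite // enum_rankK_in.
have : (`I_(#|N|).+1 #<= `I_#|N|)%card.
  rewrite (card_le_eqr card_II); apply: card_le_trans NA _.
  exact: card_le_trans (subset_card_le sub) (card_image_le _ _).
by rewrite card_le_II ltnn.
Qed.

Lemma finite_of_not_card_ge (C : Type) (A : set C) (n : nat) :
  ~ (`I_n.+1 #<= A)%card -> (A #<= `I_n)%card.
Proof.
move=> nA; have [/finite_setP[m Am]|/infiniteP infA] := pselect (finite_set A).
  rewrite (card_le_eql Am) card_le_II leqNgt; apply/negP => nm.
  by apply: nA; rewrite (card_le_eqr Am) card_le_II.
by case: nA; apply: card_le_trans infA; apply: card_leT.
Qed.

(** The common element [x] is counted twice in |A| + |B| but once in the union, which makes the
    inequality strict. *)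
Lemma card_setU_meet (C : Type) (A B : set C) (x : C) (a b n : nat) :
  (A #<= `I_a)%card -> (B #<= `I_b)%card -> A x -> B x ->
  (`I_n #<= (A `|` B)%classic)%card -> (n < a + b)%N.
Proof.
move=> Aa Bb Ax Bx nAB.
(* The cardinality of finite sets is computed over a [choiceType]; the bare type [C] is reached
   through [{classic C}]. *)
have key (D : choiceType) (A' B' : set D) (y : D) :
  (A' #<= `I_a)%card -> (B' #<= `I_b)%card -> A' y -> B' y ->
  (`I_n #<= (A' `|` B')%classic)%card -> (n < a + b)%N.
  move=> A'a B'b A'y B'y nA'B'.
  have finA := card_le_finite A'a (finite_II a).
  have finB := card_le_finite B'b (finite_II b).
  have finAB : finite_set (A' `|` B')%classic by rewrite finite_setU.
  have := leq_card_fset_set finAB nA'B'.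
  have := geq_card_fset_set A'a; have := geq_card_fset_set B'b.
  rewrite fset_setU //.
  have := cardfsUI (fset_set A') (fset_set B').
  have : (0 < #|` (fset_set A' `&` fset_set B')%fset|)%N.
    rewrite cardfs_gt0; apply/fset0Pn; exists y.
    by rewrite in_fsetI !in_fset_set // !mem_set.
  by lia.
exact: (key {classic C} A B x).
Qed.

Theorem theorem7 (k t : nat) (hk : (2 <= k)%N) (ht : (2 * k - 1 <= t)%N)
    (G : sgraph)
    (hG : Mad G < 2 * k%:R * (1 - k%:R / (t%:R + 1))) :
  choosable k t G.
Proof.
move=> C L [Lk Lt].
pose e (u v : G) := adj u v && `[< (L u `&` L v !=set0)%classic >].
have e_sym : symmetric e by move=> u v; rewrite /e adj_sym setIC.
have L0 v : exists x, L v x.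
  have [Lv0|/set0P[x Lx]] := eqVneq (L v) set0; last by exists x.
  by have := Lk v; rewrite Lv0 card_le0 => /eqP/seteqP[/(_ 0)-/(_ (ltnW hk))].
have [c0 Lc0] := boolp.choice L0.
(* For the induction on [#|W|], [c] obeys all lists but is proper only for [e] inside [W]. Taking
   all of [G] suffices: a color repeated on an edge lies in both lists, so that edge belongs to
   [e]. *)
suff colW (W : {set G}) : exists2 c : G -> C, forall v, L v (c v) &
    forall u v, u \in W -> v \in W -> e u v -> c u <> c v.
  have [c Lc cE] := colW [set: G]; exists c; split=> // u v uv cuv.
  have euv : e u v.
    rewrite /e uv; apply/asboolP; exists (c u); split; first exact: Lc.
    by rewrite cuv; exact: Lc.
  by case: (cE u v).
have [n] := ubnP #|W|; elim: n W => // n IHn W /ltnSE Wn.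
have [W0|W0] := eqVneq W finset.set0.
  by exists c0 => // u v; rewrite W0 inE.
(* Either some [v] has more colors than neighbors in [W], and it is recolored after the rest of [W],
   or every list on [W] is finite with size at most the degree, which will contradict the bound on
   [Mad]. *)
have [[v vW Lv]|noext] := pselect (exists2 v, v \in W &
    (`I_(#|nbhd_in G e W v|).+1 #<= L v)%card).
  have [|c Lc cE] := IHn (W :\ v)%SET.
    by move: Wn; rewrite (cardsD1 v W) vW.
  have [x Lx xN] := exists_outside_image _ _ _ c _ Lv.
  exists (fun u => if u == v then x else c u) => [u|u w uW wW euw].
    by case: eqP => [->|_].
  case: (eqVneq u v) (eqVneq w v) => [uv|uv] [wv|wv].
  - by move: euw; rewrite uv wv /e adj_irrefl.
  - by move/esym; apply: xN; rewrite inE wW -uv.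
  - by apply: xN; rewrite inE uW e_sym -wv.
  - by apply: cE; rewrite ?inE ?uv ?wv.
have Ld v : v \in W -> (L v #<= `I_(#|nbhd_in G e W v|))%card.
  move=> vW; apply: finite_of_not_card_ge => Lv.
  by apply: noext; exists v.
pose P := arcs_in G e W.
(* Only edges whose end lists meet are kept, so [(W, F)] need not be induced; [Mad] ranges over such
   subgraphs too. *)
pose F := [set [set p.1; p.2] | p in P].
have cardF : (2 * #|F| = #|P|)%N.
  apply: card_unordered_pairs => x y; rewrite !inE /= e_sym => /and3P[-> -> eyx].
  rewrite eyx !andbT; apply: contraTneq eyx => ->.
  by rewrite /e adj_irrefl.
have subH : is_subgraph (W, F).
  apply/andP; split => /=.
    apply/fintype.subsetP => _ /imsetP[[x y] + ->]; rewrite !inE /= => /and3P[_ _ /andP[xy _]].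
    by apply/existsP; exists x; apply/existsP; exists y; rewrite xy /=.
  apply/forall_inP => _ /imsetP[[x y] + ->]; rewrite inE /= => /and3P[xW yW _].
  by apply/fintype.subsetP => z; rewrite !inE => /orP[]/eqP->.
have := le_lt_trans (avg_degree_le_Mad _ _ subH W0) hG.
rewrite /avg_degree /= cardF.
have WP : 0 < #|W|%:R :> rat by rewrite ltr0n card_gt0.
rewrite ltr_pdivrMr // => upP.
(* Here [a] is [k] and [b] is [t + 1 - k]; the hypothesis [2k - 1 <= t] is exactly [a <= b]. *)
have lowP : (2 * #|W|)%:R <=
    #|P|%:R * (k%:R^-1 + (t.+1 - k)%:R^-1) :> rat.
  apply: harmonic_arcs_bound => //; [lia|lia| |] => [v vW|u v uW vW].
    by rewrite -card_le_II; apply: card_le_trans (Lk v) (Ld v vW).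
  move=> /andP[uv /asboolP[x [Lux Lvx]]].
  have := card_setU_meet _ _ _ _ _ _ _ (Ld u uW) (Ld v vW) Lux Lvx (Lt u v uv).
  by lia.
have kE : 0 < k%:R :> rat by rewrite ltr0n; lia.
have bE : 0 < (t.+1 - k)%:R :> rat by rewrite ltr0n; lia.
have tE : t%:R + 1 = k%:R + (t.+1 - k)%:R :> rat.
  by rewrite natr1 -natrD; congr (_%:R); lia.
have : #|P|%:R * (k%:R^-1 + (t.+1 - k)%:R^-1) < (2 * #|W|)%:R :> rat.
  (* The bound on [Mad] times 1/k + 1/(t + 1 - k) equals 2. *)
  have -> : (2 * #|W|)%:R = 2 * k%:R * (1 - k%:R / (t%:R + 1)) * #|W|%:R *
      (k%:R^-1 + (t.+1 - k)%:R^-1) :> rat.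
    rewrite tE natrM; field.
    by rewrite !gt_eqF // addr_gt0.
  by rewrite ltr_pM2r // addr_gt0 ?invr_gt0.
by rewrite ltNge lowP.
Qed.
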